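(* Let $K,L\subset\mathbb{R}^d$ be two unconditional convex bodies. Then $$\mathrm{Vol}(T(K)+L)\le\mathrm{Vol}(K+L)$$ holds for any strong contraction $T:\mathbb{R}^d\to\mathbb{R}^d$.
   Context: A convex body $K\subset\mathbb{R}^d$ is unconditional if $(x_1,\dots,x_d)\in K$ implies $(\pm x_1,\dots,\pm x_d)\in K$ for every choice of signs. A map $T=(T_1,\dots,T_d):\mathbb{R}^d\to\mathbb{R}^d$ is a strong contraction if $|T_i(x)-T_i(y)|\le|x_i-y_i|$ for all $i=1,\dots,d$ and all $x,y\in\mathbb{R}^d$. $\mathrm{Vol}$ is Lebesgue measure, and sums of sets are Minkowski sums. *)

(* Defs.v *)
From HB Require Import structures.
From mathcomp Require Import all_boot all_order all_algebra.
From mathcomp Require Import all_classical all_reals all_analysis.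

Set Implicit Arguments.
Unset Strict Implicit.
Unset Printing Implicit Defensive.

Import Order.TTheory GRing.Theory Num.Theory.
Import numFieldNormedType.Exports.

Local Open Scope classical_set_scope.
Local Open Scope ring_scope.

(* The n-fold product of [lebesgue_measure], on the product sigma-algebra of
   [n.-tuple R], built by transporting [lebesgue_measure \x mu] along the
   bijection [R * n.-tuple R -> n.+1.-tuple R]. *)
Section lebesgue_tuple.
Context (R : realType).
Local Notation RT := (measurableTypeR R).
Local Open Scope ereal_scope.

Definition pair_cons n (p : RT * n.-tuple RT) : n.+1.-tuple RT :=
  [the n.+1.-tuple RT of p.1 :: p.2].

Definition tuple_uncons n (t : n.+1.-tuple RT) : RT * n.-tuple RT :=
  (tnth t ord0, [tuple of behead t]).

Lemma pair_consK n : cancel (@pair_cons n) (@tuple_uncons n).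
Proof.
move=> [x t]; rewrite /tuple_uncons /pair_cons/=; congr pair; exact: val_inj.
Qed.

Lemma measurable_pair_cons n : measurable_fun [set: _] (@pair_cons n).
Proof. exact: measurable_cons. Qed.

Lemma measurable_tuple_uncons n : measurable_fun [set: _] (@tuple_uncons n).
Proof.
apply: measurable_fun_pair; first exact: measurable_tnth.
exact: measurable_behead.
Qed.

Section step.
Variables (n : nat) (mu : {sigma_finite_measure set (n.-tuple RT) -> \bar R}).

Definition lebesgue_tuple_step : set (n.+1.-tuple RT) -> \bar R :=
  pushforward (@lebesgue_measure R \x mu) (@pair_cons n).

Let step0 : lebesgue_tuple_step set0 = 0.
Proof. by rewrite /lebesgue_tuple_step /pushforward preimage_set0 measure0. Qed.

Let step_ge0 A : 0 <= lebesgue_tuple_step A.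
Proof.
exact: (@measure_ge0 _ _ _
  (measure_function_pushforward__canonical__measure_function_Measure
     (@lebesgue_measure R \x mu) (@measurable_pair_cons n))).
Qed.

Let step_sigma_additive : semi_sigma_additive lebesgue_tuple_step.
Proof.
exact: (@measure_semi_sigma_additive _ _ _
  (measure_function_pushforward__canonical__measure_function_Measure
     (@lebesgue_measure R \x mu) (@measurable_pair_cons n))).
Qed.

HB.instance Definition _ := isMeasure.Build _ _ _
  lebesgue_tuple_step step0 step_ge0 step_sigma_additive.

Let step_sigma_finite : sigma_finite setT lebesgue_tuple_step.
Proof.
have /sigma_finiteP[F [FT ndF Foo]] := sigma_finiteT (@lebesgue_measure R).
have /sigma_finiteP[G [GT ndG Goo]] := sigma_finiteT mu.
exists (fun k => @tuple_uncons n @^-1` (F k `*` G k)).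
  rewrite -preimage_bigcup (_ : \bigcup_k _ = setT) ?preimage_setT//.
  apply/seteqP; split=> // -[x t] _ /=.
  have [i _ Fi] : (\bigcup_k F k) x by rewrite -FT.
  have [j _ Gj] : (\bigcup_k G k) t by rewrite -GT.
  exists (maxn i j) => //; split.
    by move: x Fi; exact/subsetPset/ndF/leq_maxl.
  by move: t Gj; exact/subsetPset/ndG/leq_maxr.
move=> k; have [mF Fk] := Foo k; have [mG Gk] := Goo k; split.
  rewrite -[X in measurable X]setTI; apply: measurable_tuple_uncons => //.
  exact: measurableX.
rewrite /lebesgue_tuple_step /pushforward -comp_preimage.
rewrite (_ : _ \o _ = id) ?preimage_id; last first.
  by apply/funext => p /=; rewrite pair_consK.
by rewrite product_measure1E// lte_mul_pinfty// ge0_fin_numE.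
Qed.

HB.instance Definition _ := Measure_isSigmaFinite.Build _ _ _
  lebesgue_tuple_step step_sigma_finite.

End step.

Fixpoint lebesgue_tuple n : {sigma_finite_measure set (n.-tuple RT) -> \bar R} :=
  match n with
  | 0 => \d_[tuple]
  | n'.+1 => lebesgue_tuple_step (lebesgue_tuple n')
  end.

Lemma measurable_tuple_box n (A : 'I_n -> set RT) :
  (forall i, measurable (A i)) ->
  measurable [set t : n.-tuple RT | forall i, A i (tnth t i)].
Proof.
move=> mA.
rewrite (_ : [set _ | _] =
  \bigcap_(i in [set: 'I_n]) ((@tnth n RT)^~ i @^-1` A i)); last first.
  by apply/seteqP; split=> [t At i _|t At i]; [exact: At|exact: (At i)].
apply: fin_bigcap_measurable => // i _.
by rewrite -[X in measurable X]setTI; exact: measurable_tnth.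
Qed.

Lemma lebesgue_tuple_box n (A : 'I_n -> set RT) :
  (forall i, measurable (A i)) ->
  lebesgue_tuple n [set t | forall i, A i (tnth t i)] =
  \prod_(i < n) lebesgue_measure (A i).
Proof.
elim: n A => [|n IHn] A mA.
  by rewrite big_ord0 /= diracE mem_set//= => -[].
rewrite big_ord_recl /= /lebesgue_tuple_step /pushforward.
rewrite (_ : _ @^-1` _ = A ord0 `*`
  [set t | forall i, A (lift ord0 i) (tnth t i)]); last first.
  apply/seteqP; split=> -[x t] /=.
    move=> At; split; first exact: (At ord0).
    by move=> i; have := At (lift ord0 i); rewrite tnthS.
  move=> [A0 At] i; have [j ->|->//] := unliftP ord0 i.
  by rewrite tnthS; exact: At.
rewrite product_measure1E//.
  by rewrite (IHn (fun i => A (lift ord0 i))).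
exact: (@measurable_tuple_box _ (fun i => A (lift ord0 i))).
Qed.

End lebesgue_tuple.

Section euclidean.
Context (R : realType) (d : nat).
Implicit Types (A B K L : set 'rV[R]_d) (T : 'rV[R]_d -> 'rV[R]_d).

(* Lebesgue measure on R^d, through the coordinate identification of
   ['rV[R]_d] with [d.-tuple R]. It is meaningful for Borel sets. *)
Definition Vol A : \bar R :=
  lebesgue_tuple R d [set t : d.-tuple R | A (\row_i tnth t i)].

Definition minkowski_sum A B : set 'rV[R]_d :=
  [set x + y | x in A & y in B].

Definition convex_body K : Prop :=
  [/\ compact K, convex_set K & K^° !=set0].

Definition unconditional K : Prop :=
  forall x (s : 'I_d -> bool), K x -> K (\row_i ((-1) ^+ s i * x ord0 i)).

Definition strong_contraction T : Prop :=
  forall (i : 'I_d) x y,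
    `|T x ord0 i - T y ord0 i| <= `|x ord0 i - y ord0 i|.

End euclidean.

(* Main.v *)
(* A strong contraction acts coordinatewise, T_i(x) = t_i(x_i) with t_i
   1-Lipschitz, so T can be applied to K one coordinate at a time. When t_k is
   applied, compare sections in direction k. For x in K and l in L whose sum
   has the prescribed other coordinates, K and L being unconditional and
   convex, the section before the step contains [-(|x_k| + |l_k|),
   |x_k| + |l_k|]. Two points t_k(x_k) + l_k and t_k(y_k) + m_k of the section
   after the step are at distance at most |x_k - y_k| + |l_k - m_k|
   <= 2 max(|x_k| + |l_k|, |y_k| + |m_k|), so its diameter is at most the
   length of the former section; Fubini concludes. *)

Require Import Defs.
From mathcomp Require Import all_boot all_order all_algebra.
From mathcomp Require Import all_classical all_reals all_analysis.
From mathcomp Require Import ring lra.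

Set Implicit Arguments.
Unset Strict Implicit.
Unset Printing Implicit Defensive.

Import Order.TTheory GRing.Theory Num.Theory.
Import numFieldNormedType.Exports.

Local Open Scope classical_set_scope.
Local Open Scope ring_scope.

(** Only the diameter of [G] matters: [G] lies in [[inf G, sup G]], and each distance [|g - h|] is
    at most the length of an interval [[-M, M]] inside [F]. Since [M] may depend on [g] and [h], no
    largest interval in [F] has to be found. *)
Lemma lebesgue_measure_le_spread (R : realType) (F G : set (measurableTypeR R)) :
    measurable F -> measurable G ->
    (forall g h : R, G g -> G h ->
      exists M : R, `|g - h| <= M *+ 2 /\ (forall s : R, `|s| <= M -> F s)) ->
  (lebesgue_measure G <= lebesgue_measure F)%E.
Proof.
move=> mF mG GF.
have [Foo|Ffin] := eqVneq (lebesgue_measure F) +oo%E; first by rewrite Foo leey.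
have Ffn : lebesgue_measure F \is a fin_num.
  by rewrite ge0_fin_numE ?measure_ge0// ltey.
have spread (g h : R) : G g -> G h -> `|g - h| <= fine (lebesgue_measure F).
  move=> /GF /[apply] -[M [ghM MF]].
  apply: (le_trans ghM); rewrite -lee_fin fineK//.
  have [->|M0] := eqVneq M 0; first by rewrite mul0rn measure_ge0.
  have {M0} M0 : - M < M.
    have := le_trans (normr_ge0 _) ghM.
    by rewrite pmulrn_lge0// le0r (negbTE M0)/= => /gtrN.
  have -> : (M *+ 2)%:E = lebesgue_measure `[- M, M]%classic.
    by rewrite lebesgue_measure_itv/= lte_fin M0 -EFinD opprK mulr2n.
  apply: le_measure; rewrite ?inE//.
  by move=> s /=; rewrite in_itv/= -ler_norml; exact: MF.
have [->|/set0P[g Gg]] := eqVneq G set0; first by rewrite measure0 measure_ge0.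
have hsG : has_sup G.
  split; first by exists g.
  exists (g + fine (lebesgue_measure F)) => h Gh.
  by have := spread _ _ Gh Gg; rewrite ler_distl => /andP[].
have hiG : has_inf G.
  split; first by exists g.
  exists (g - fine (lebesgue_measure F)) => h Gh.
  by have := spread _ _ Gh Gg; rewrite ler_distl => /andP[].
have supinf : sup G - inf G <= fine (lebesgue_measure F).
  rewrite lerBlDr; apply: ge_sup; first by exists g.
  move=> h Gh; rewrite -lerBlDl; apply: lb_le_inf; first by exists g.
  move=> k Gk; have := spread _ _ Gh Gk.
  by rewrite ler_distl => /andP[_]; rewrite lerBlDr.
apply: (@le_trans _ _ (lebesgue_measure `[inf G, sup G]%classic)).
  apply: le_measure; rewrite ?inE//.
  move=> h Gh /=; rewrite in_itv/=.
  by apply/andP; split; [exact: (ge_inf hiG.2)|exact: (ub_le_sup hsG.2)].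
rewrite lebesgue_measure_itv/= lte_fin; case: ifPn => _.
  by rewrite -EFinB -[leRHS]fineK// lee_fin.
exact: measure_ge0.
Qed.

(** The [i]-th entry of [t] is overwritten rather than omitted, so sections in all directions are
    indexed by full [n]-tuples. *)
Definition line {T : Type} {n : nat} (i : 'I_n) (t : n.-tuple T)
    (A : set (n.-tuple T)) : set T :=
  [set s | A [tuple if j == i then s else tnth t j | j < n]].

Lemma measurable_line d (T : measurableType d) (n : nat) (i : 'I_n)
    (t : n.-tuple T) (A : set (n.-tuple T)) :
  measurable A -> measurable (line i t A).
Proof.
move=> mA; rewrite -[X in measurable X]setTI.
have mf : measurable_fun [set: T]
    (fun s => [tuple if j == i then s else tnth t j | j < n]).
  apply/measurable_fun_tnthP => j; rewrite /comp.
  under eq_fun do rewrite tnth_mktuple.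
  by case: (j == i); [exact: measurable_id|exact: measurable_cst].
exact: mf.
Qed.

(** Fubini, by induction on [n]: the head coordinate is integrated last when [i] is in the tail, and
    first when [i] is the head. *)
Lemma lebesgue_tuple_le (R : realType) (n : nat) (i : 'I_n)
    (A B : set (n.-tuple (measurableTypeR R))) :
    measurable A -> measurable B ->
    (forall t,
      (lebesgue_measure (line i t A) <= lebesgue_measure (line i t B))%E) ->
  (lebesgue_tuple R n A <= lebesgue_tuple R n B)%E.
Proof.
elim: n i A B => [[]//|n IHn] i A B mA mB leAB.
have mpre C : measurable C -> measurable (@pair_cons R n @^-1` C).
  by move=> mC; rewrite -[X in measurable X]setTI; exact: measurable_pair_cons.
have [j ij|i0] := unliftP ord0 i.
  rewrite /= /lebesgue_tuple_step /pushforward /product_measure1.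
  apply: ge0_le_integral => //=; [exact: measurable_fun_xsection (mpre _ mA)
    |exact: measurable_fun_xsection (mpre _ mB)|].
  move=> x _; apply: (IHn j).
  - exact: measurable_xsection (mpre _ mA).
  - exact: measurable_xsection (mpre _ mB).
  move=> t; have lineE C : line j t (xsection (@pair_cons R n @^-1` C) x) =
      line i (pair_cons (x, t)) C.
    rewrite /line; apply/funext => s /=; rewrite xsectionE/=.
    congr (C _); apply: eq_from_tnth => k; rewrite tnth_mktuple ij.
    have [k' ->|->] := unliftP ord0 k.
      by rewrite !tnthS tnth_mktuple (inj_eq lift_inj).
    by rewrite (negbTE (neq_lift _ _)) !tnth0.
  by rewrite !lineE; exact: leAB.
rewrite /= /lebesgue_tuple_step /pushforward.
(* Here [i] is the head: uniqueness of the product measure allows the other order of integration,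
   with the sections in the head direction measured first. *)
have swap C : measurable C ->
    ((@lebesgue_measure R \x lebesgue_tuple R n) C =
     (@lebesgue_measure R \x^ lebesgue_tuple R n) C)%E.
  move=> mC; apply: product_measure_unique => // X Y mX mY.
  exact: product_measure2E.
rewrite !swap; [|exact: mpre..]; rewrite /product_measure2.
apply: ge0_le_integral => //=; [exact: measurable_fun_ysection (mpre _ mA)
  |exact: measurable_fun_ysection (mpre _ mB)|].
(* The head [0] is a placeholder that [line] overwrites. *)
move=> t _; have lineE C : ysection (@pair_cons R n @^-1` C) t =
    line i (pair_cons (0, t)) C.
  rewrite /line; apply/funext => s /=; rewrite ysectionE/=.
  congr (C _); apply: eq_from_tnth => k; rewrite tnth_mktuple i0.
  have [k' ->|->] := unliftP ord0 k; last by rewrite eqxx tnth0.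
  by rewrite !tnthS eq_sym (negbTE (neq_lift _ _)).
by rewrite !lineE; exact: leAB.
Qed.

(** The sigma-algebra on tuples is the product one, so the open complement is written as a countable
    union of boxes with rational centres and radii [1 / (k + 1)]. *)
Lemma measurable_closed_tuple (R : realType) (d : nat) (A : set 'rV[R]_d) :
  closed A ->
  measurable [set t : d.-tuple (measurableTypeR R) | A (\row_i tnth t i)].
Proof.
move=> cA; rewrite -[X in measurable X]setCK; apply: measurableC.
pose box (q : {ffun 'I_d -> rat} * nat) (t : d.-tuple (measurableTypeR R)) :=
  forall i, `|ratr (q.1 i) - tnth t i| < q.2.+1%:R^-1.
pose D := [set q | box q `<=` [set t | (~` A) (\row_i tnth t i)]].
rewrite (_ : ~` _ = \bigcup_(q in D) box q); last first.
  apply/seteqP; split=> [t /= At|t [q Dq qt]]; last exact: (Dq t qt).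
  have /nbhs_ballP[e /= e0 eA] : nbhs (\row_i tnth t i : 'rV[R]_d) (~` A).
    by apply: open_nbhs_nbhs; split => //; exact: closed_openC.
  (* Half of [e], because a point of the box is compared with [t] through the rational centre. *)
  have [k ke] : exists k : nat, k.+1%:R^-1 < e / 2.
    have := near_infty_natSinv_lt (PosNum (divr_gt0 e0 (ltr0Sn _ 1))).
    by move=> [k _ /(_ k (leqnn _))] ?; exists k.
  have qex i : exists q : rat, `|ratr q - tnth t i| < k.+1%:R^-1 :> R.
    have := @rat_in_itvoo R (tnth t i - k.+1%:R^-1) (tnth t i + k.+1%:R^-1).
    rewrite ltrBlDr -addrA ltrDl addr_gt0 ?invr_gt0// => /(_ isT)[q].
    by rewrite in_itv/= -ltr_distl; exists q.
  have [q qP] := choice qex.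
  exists ([ffun i => q i], k) => [|i]; last by rewrite ffunE; exact: qP.
  move=> u /= ut; apply: eA; split => // a i.
  rewrite !mxE /ball/= (le_lt_trans (ler_distD (ratr (q i)) _ _))// (splitr e).
  rewrite ltrD// (lt_trans _ ke)//; first by rewrite distrC; exact: qP.
  by have := ut i; rewrite ffunE.
rewrite bigcup_mkcond; apply: countable_bigcupT_measurable => // q.
case: ifPn => // _; apply: (@measurable_tuple_box R d
  (fun i => [set s : R | `|ratr (q.1 i) - s| < q.2.+1%:R^-1])) => i.
rewrite (_ : mkset _ =
    `]ratr (q.1 i) - q.2.+1%:R^-1, ratr (q.1 i) + q.2.+1%:R^-1[%classic).
  exact: measurable_itv.
by apply/seteqP; split => s /=; rewrite in_itv/= distrC ltr_distl.
Qed.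

Lemma strong_contraction_continuous (R : realType) (d : nat)
    (T : 'rV[R]_d -> 'rV[R]_d) : strong_contraction T -> continuous T.
Proof.
move=> cT x U /nbhs_ballP[e /= e0 eU]; apply/nbhs_ballP.
exists e => // y [_ xy]; apply: eU.
by split=> // a i; rewrite (ord1 a); apply: (le_lt_trans (cT i x y)); exact: xy.
Qed.

Lemma minkowski_sum_compact (R : realType) (d : nat) (A B : set 'rV[R]_d) :
  compact A -> compact B -> compact (minkowski_sum A B).
Proof.
move=> cA cB.
have -> : minkowski_sum A B = [set p.1 + p.2 | p in A `*` B].
  apply/seteqP; split=> [_ [x Ax [y By <-]]|_ [[x y] [Ax By] <-]].
    by exists (x, y).
  by exists x => //; exists y.
apply: continuous_compact; last exact: compact_setX.
by apply: continuous_subspaceT => p; exact: add_continuous.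
Qed.

Definition set_coord (R : Type) (d : nat) (x : 'rV[R]_d) (i : 'I_d) (s : R) :
  'rV[R]_d := \row_j (if j == i then s else x ord0 j).

Lemma unconditional_set_coord (R : realType) (d : nat) (K : set 'rV[R]_d)
    (x : 'rV[R]_d) (i : 'I_d) (s : R) :
    convex_set K -> unconditional K -> K x -> `|s| <= `|x ord0 i| ->
  K (set_coord x i s).
Proof.
move=> cK uK Kx sx.
have [x0|x0] := eqVneq (x ord0 i) 0.
  have s0 : s = 0 by apply/eqP; rewrite -normr_le0 (le_trans sx)// x0 normr0.
  rewrite (_ : set_coord _ _ _ = x)//; apply/rowP => j; rewrite mxE.
  by case: eqP => // ->; rewrite s0 x0.
pose y : 'rV[R]_d := \row_j ((-1) ^+ (j == i) * x ord0 j).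
have Ky : K y by exact: uK.
(* [y] is the reflection of [x] in coordinate [i]; the weight [p] on [x] solves
   [p * x_i - (1 - p) * x_i = s]. *)
pose p : R := (1 + s / x ord0 i) / 2.
have sxN : `|s / x ord0 i| <= 1.
  by rewrite normf_div ler_pdivrMr ?normr_gt0// mul1r.
have /andP[p0 p1] : 0 <= p <= 1.
  by move: sxN; rewrite ler_norml /p => /andP[? ?]; apply/andP; split; lra.
have := cK x y (Itv01 p0 p1) (mem_set Kx) (mem_set Ky).
rewrite inE; congr K; apply/rowP => j; rewrite !mxE /=.
case: eqP => [->|_] /=; last by rewrite expr0 mul1r -mulrDl subrKC mul1r.
by rewrite expr1 /unstable.onem /p (_ : 0 = ord0 :> 'I_1)//; field.
Qed.

(** Interpolates from the identity ([k = 0]) to [T] ([k = d]), one coordinate per step. *)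
Definition partial_map (R : Type) (d k : nat) (T : 'rV[R]_d -> 'rV[R]_d)
  (x : 'rV[R]_d) : 'rV[R]_d :=
  \row_j (if (j < k)%N then T x ord0 j else x ord0 j).

Lemma strong_contraction_partial (R : realType) (d k : nat)
    (T : 'rV[R]_d -> 'rV[R]_d) :
  strong_contraction T -> strong_contraction (partial_map k T).
Proof. by move=> cT i x y; rewrite !mxE; case: ifP. Qed.

Lemma split_normr (R : realDomainType) (s a b : R) : 0 <= a -> 0 <= b ->
  `|s| <= a + b -> exists u v, [/\ s = u + v, `|u| <= a & `|v| <= b].
Proof.
move=> a0 b0; rewrite ler_norml => /andP[sl su].
(* [u] is [s] truncated to [[-a, a]], and [v] is the remainder. *)
have [as_|sa] := lerP a s.
  by exists a, (s - a); split; rewrite ?ler_norml; first lra;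
    apply/andP; split; lra.
have [sa'|as'] := lerP s (- a).
  by exists (- a), (s + a); split; rewrite ?ler_norml; first lra;
    apply/andP; split; lra.
by exists s, 0; split; rewrite ?ler_norml; first lra; apply/andP; split; lra.
Qed.

Lemma Vol_partial_mapS (R : realType) (d : nat) (K L : set 'rV[R]_d)
    (T : 'rV[R]_d -> 'rV[R]_d) (k : 'I_d) :
    convex_body K -> unconditional K -> convex_body L -> unconditional L ->
    strong_contraction T ->
  (Vol (minkowski_sum (partial_map k.+1 T @` K) L) <=
   Vol (minkowski_sum (partial_map k T @` K) L))%E.
Proof.
move=> [cK vK _] uK [cL vL _] uL cT.
have msum m : measurable [set t : d.-tuple (measurableTypeR R) |
    minkowski_sum (partial_map m T @` K) L (\row_i tnth t i)].
  (* Each intermediate sum is compact, as a sum of [L] and a continuous image of [K]. *)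
  apply: measurable_closed_tuple; apply: compact_closed.
    exact: norm_hausdorff.
  apply: minkowski_sum_compact => //; apply: continuous_compact => //.
  apply: continuous_subspaceT; apply: strong_contraction_continuous.
  exact: strong_contraction_partial.
rewrite /Vol; apply: (@lebesgue_tuple_le _ _ k) => // t.
apply: lebesgue_measure_le_spread; [exact: measurable_line..|].
pose row g : 'rV[R]_d :=
  \row_i tnth [tuple if j == k then g else tnth t j | j < d] i.
have fiber z n g : K z -> L n -> partial_map k.+1 T z + n = row g ->
    g = T z ord0 k + n ord0 k /\
    forall s, `|s| <= `|z ord0 k| + `|n ord0 k| ->
      minkowski_sum (partial_map k T @` K) L (row s).
  move=> Kz Ln /rowP zng; split.
    by have := zng k; rewrite !mxE tnth_mktuple eqxx leqnn.
  (* The new [k]-th coordinate [s] is shared out: [u] replaces that of [z] in [K], and [v] that of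
     [n] in [L]. *)
  move=> s /split_normr[||u [v [-> uz vn]]] //.
  exists (partial_map k T (set_coord z k u)).
    by exists (set_coord z k u) => //; exact: unconditional_set_coord.
  exists (set_coord n k v); first exact: unconditional_set_coord.
  apply/rowP => j; have := zng j; rewrite !mxE !tnth_mktuple.
  (* [partial_map k] still leaves coordinate [k] alone, so the sum there is exactly [u + v]. *)
  have [->|jk] := eqVneq j k; first by rewrite ltnn.
  rewrite ltnS [(j <= k)%N]leq_eqVlt (negbTE (jk : (j != k :> nat)))/= => <-.
  (* For [j < k], changing coordinate [k] of [z] does not affect [T_j]: the contraction bound in
     coordinate [j] is [0]. *)
  case: ifP => // _; congr (_ + _); apply/eqP; rewrite -subr_eq0 -normr_le0.
  by rewrite (le_trans (cT _ _ _))// mxE (negbTE jk) subrr normr0.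
move=> g h [_ [x Kx <-] [l Ll xlg]] [_ [y Ky <-] [m Lm ymh]].
have [-> xF] := fiber _ _ _ Kx Ll xlg; have [-> yF] := fiber _ _ _ Ky Lm ymh.
exists (Num.max (`|x ord0 k| + `|l ord0 k|) (`|y ord0 k| + `|m ord0 k|)); split.
  rewrite opprD addrACA (le_trans (ler_normD _ _))//.
  have := le_trans (cT k x y) (ler_normB _ _).
  have := ler_normB (l ord0 k) (m ord0 k).
  by case: (leP (`|x ord0 k| + `|l ord0 k|)) => *; lra.
(* Whichever pair attains the maximum, its own symmetric interval contains [s]. *)
by move=> s; rewrite le_max => /orP[/xF|/yF].
Qed.

Theorem corollary2p10 (R : realType) (d : nat) (K L : set 'rV[R]_d)
    (T : 'rV[R]_d -> 'rV[R]_d)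
    (cK : convex_body K) (uK : unconditional K)
    (cL : convex_body L) (uL : unconditional L)
    (cT : strong_contraction T) :
  (Vol (minkowski_sum (T @` K) L) <= Vol (minkowski_sum K L))%E.
Proof.
have le_partial k : (k <= d)%N ->
    (Vol (minkowski_sum (partial_map k T @` K) L) <= Vol (minkowski_sum K L))%E.
  elim: k => [_|k IHk kd].
    rewrite (_ : partial_map 0 T = id) ?image_id//.
    by apply/funext => x; apply/rowP => j; rewrite mxE.
  exact: le_trans (Vol_partial_mapS (Ordinal kd) cK uK cL uL cT) (IHk (ltnW kd)).
have := le_partial _ (leqnn d).
rewrite (_ : partial_map d T = T)//.
by apply/funext => x; apply/rowP => j; rewrite mxE ltn_ord.
Qed.
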